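(* For every $n\ge 1$, the map $\hat{\gamma}:\mathcal{CK}_n\to\mathcal{Q}_n$, from the lattice $\mathcal{CK}_n$ of weighted trees with weights summing to $n$ to the Boolean lattice $\mathcal{Q}_n$ of subsets of $\{1,\dots,n-1\}$, which replaces the painted portion of a weighted tree by a corolla, is an interval retract.
   Context: Binary trees. A planar rooted binary tree (binary tree) with $m$ internal nodes has $m+1$ leaves; $\mathcal{Y}_m$ denotes the set of these. Internal nodes are numbered $1,\dots,m$ from left to right (in-order: node $i$ separates the $i$-th leaf from the $(i+1)$-st leaf), and are also partially ordered by proximity to the root, the root being maximal (the node poset). An upper order ideal of the node poset is a subset containing, with any node, all nodes on the path from it to the root. $\mathcal{Y}_m$ carries the Tamari order: the partial order generated by replacing a subtree $((a\,b)\,c)$ by $(a\,(b\,c))$, the latter being larger; left combs are minimal and right combs maximal. Painted trees. A painted tree $p=(t;P)$ is a binary tree $t$ with a (possibly empty) upper order ideal $P$ of its node poset, the painted nodes. Its painted portion is the binary tree formed by the painted nodes, with $k=|P|+1$ leaves (a single edge if $P=\emptyset$); the parts of $t$ above these $k$ leaves form the ordered unpainted forest $(f_1,\dots,f_k)$ of binary trees (some possibly a single leaf with no nodes), listed left to right. $\mathcal{M}_n$ denotes the set of painted trees with $n$ leaves (i.e. $n-1$ internal nodes), with order $(s;S)\le(t;T)$ if $s\le t$ in the Tamari order on $\mathcal{Y}_{n-1}$ and $T\subseteq S$ as subsets of $\{1,\dots,n-1\}$. Weighted trees. A weighted tree is a (painted) binary tree with a corolla (a rooted tree with one interior node) grafted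 to each leaf; each corolla is equivalently recorded as a positive integer weight, its number of leaves, or as the right comb with that number of leaves (weight $1$ meaning a single leaf). $\mathcal{CK}_n$ is the set of weighted trees whose weights sum to $n$. Using right combs for the corollas, $\mathcal{CK}_n$ is identified with the set of painted trees in $\mathcal{M}_n$ all of whose unpainted trees $f_i$ are right combs, and it is given the same order relation as in $\mathcal{M}_n$ (restricted to this subset). With this order it is a finite lattice. Composition trees. A composition tree is a forest of unpainted corollas (or right combs), with leaf numbers $w_1,\dots,w_k\ge1$ from left to right, grafted to a painted corolla (or left comb) with $k$ leaves; those with $\sum w_i=n$ correspond to compositions $(w_1,\dots,w_k)$ of $n$. Drawn with combs, it has $n-1$ internal nodes numbered $1,\dots,n-1$ from left to right, the painted ones being in positions $w_1,\ w_1+w_2,\ \dots,\ w_1+\cdots+w_{k-1}$. It is identified with its set of unpainted nodes, a subset of $\{1,\dots,n-1\}$. $\mathcal{Q}_n$ is the set of all such subsets ordered by inclusion. The map. $\hat{\gamma}$ replaces the painted portion of a weighted tree by a corolla (equivalently by a left comb with the same number of leaves), keeping the left-to-right sequence of weights $(w_1,\dots,w_k)$; as a subset, its value is $\{1,\dots,n-1\}\setminus\{w_1,\,w_1+w_2,\dots,w_1+\cdots+w_{k-1}\}$. Interval retract. An interval of a poset is a sub-poset $[a,b]=\{x\mid a\le x\le b\}$. A surjective poset map (order-preserving map) $f:P\to Q$ from a finite lattice $P$ is an interval retract if the fibers of $f$ are intervals and $f$ admits an order-preserving section $g:Q\to P$ with $f\circ g=\mathrm{id}$. *)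

(* Defs.v *)
From HB Require Import structures.
From mathcomp Require Import all_boot all_order zify.
Set Implicit Arguments.
Unset Strict Implicit.
Unset Printing Implicit Defensive.
Import Order.TTheory.
Local Open Scope order_scope.

(** * Planar rooted binary trees *)

Inductive btree := Leaf | Node of btree & btree.

Fixpoint tree_of_btree (t : btree) : GenTree.tree void :=
  if t is Node l r then GenTree.Node 1 [:: tree_of_btree l; tree_of_btree r]
  else GenTree.Node 0 [::].

Fixpoint btree_of_tree (u : GenTree.tree void) : btree :=
  if u is GenTree.Node 1 [:: l; r]
  then Node (btree_of_tree l) (btree_of_tree r) else Leaf.

Lemma tree_of_btreeK : cancel tree_of_btree btree_of_tree.
Proof. by elim=> //= l -> r ->. Qed.

HB.instance Definition _ := Countable.copy btree (can_type tree_of_btreeK).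

Fixpoint nodes (t : btree) : nat :=
  if t is Node l r then (nodes l + nodes r).+1 else 0.

Fixpoint leaves (t : btree) : nat :=
  if t is Node l r then leaves l + leaves r else 1.

(* The right comb with [m] internal nodes, hence [m.+1] leaves. *)
Definition right_comb (m : nat) : btree := iter m (Node Leaf) Leaf.

Definition is_right_comb (t : btree) : bool := t == right_comb (nodes t).

(* In-order numbering of the internal nodes, starting at 0: the root of
   [Node l r] is node [nodes l].  [root_path t i] lists the nodes on the path
   between the root and node [i], both included. *)
Fixpoint root_path (t : btree) (i : nat) : seq nat :=
  if t is Node l r then
    let k := nodes l in
    k :: (if (i < k)%N then root_path l i
          else if i == k then [::]
          else [seq (k.+1 + j)%N | j <- root_path r (i - k.+1)])
  else [::].

(* The node poset: the root is the largest element. *)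
Definition node_le (t : btree) : rel nat := fun i j => j \in root_path t i.

(* The trees obtained by replacing one subtree ((a b) c) by (a (b c)). *)
Fixpoint rotations (t : btree) : seq btree :=
  if t is Node l r then
    (if l is Node a b then [:: Node a (Node b r)] else [::])
      ++ [seq Node l' r | l' <- rotations l]
      ++ [seq Node l r' | r' <- rotations r]
  else [::].

(** * The Tamari order on the trees with [m] internal nodes *)

Record Y (m : nat) := YTree { yval :> btree; _ : nodes yval == m }.

HB.instance Definition _ m := [isSub for @yval m].
HB.instance Definition _ m := [Countable of Y m by <:].

Fixpoint trees_upto_height (h : nat) : seq btree :=
  if h is h'.+1 then
    Leaf :: [seq Node l r | l <- trees_upto_height h', r <- trees_upto_height h']
  else [:: Leaf].

Lemma mem_trees_upto_height h t : (nodes t <= h)%N -> t \in trees_upto_height h.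
Proof.
elim: h t => [|h IHh] [|l r] //= le_h; rewrite inE; apply/orP; right.
by apply/allpairsP; exists (l, r); split=> //=; apply: IHh; lia.
Qed.

Section YFinite.
Variable m : nat.

Definition Y_enum : seq (Y m) := undup (pmap insub (trees_upto_height m)).

Lemma Y_enumP : Finite.axiom Y_enum.
Proof.
apply: Finite.uniq_enumP => [|t]; first exact: undup_uniq.
rewrite mem_undup mem_pmap_sub; apply: mem_trees_upto_height.
by rewrite (eqP (valP t)).
Qed.

HB.instance Definition _ := isFinite.Build (Y m) Y_enumP.

End YFinite.

Definition tamari (m : nat) : rel (Y m) :=
  connect (fun s t : Y m => val t \in rotations (val s)).

(* A statistic that strictly increases under rotations; it is used only to
   obtain antisymmetry. *)
Fixpoint right_weight (t : btree) : nat :=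
  if t is Node l r then right_weight l + right_weight r + nodes r else 0.

Lemma rotations_nodes s t : t \in rotations s -> nodes t = nodes s.
Proof.
elim: s t => [|l IHl r IHr] t //=; rewrite !mem_cat => /or3P[].
- by case: l {IHl} => // a b; rewrite inE => /eqP-> /=; lia.
- by case/mapP=> l' /IHl e ->; rewrite /= e.
- by case/mapP=> r' /IHr e ->; rewrite /= e.
Qed.

Lemma rotations_right_weight s t :
  t \in rotations s -> (right_weight s < right_weight t)%N.
Proof.
elim: s t => [|l IHl r IHr] t //=; rewrite !mem_cat => /or3P[].
- by case: l {IHl} => // a b; rewrite inE => /eqP-> /=; lia.
- by case/mapP=> l' /IHl lt_l ->; rewrite /= !ltn_add2r.
- case/mapP=> r' r'P ->; rewrite /= (rotations_nodes r'P) ltn_add2r ltn_add2l.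
  exact: IHr.
Qed.

Lemma tamari_right_weight m (s t : Y m) :
  tamari s t -> s = t \/ (right_weight s < right_weight t)%N.
Proof.
case/connectP=> p; elim: p s => [|u p IHp] s /=; first by move=> _ ->; left.
case/andP=> /rotations_right_weight lt_su /IHp/[apply] -[<-|lt_ut]; right=> //.
exact: ltn_trans lt_ut.
Qed.

Lemma tamari_anti m : antisymmetric (@tamari m).
Proof.
move=> s t /andP[/tamari_right_weight[//|lt_st] /tamari_right_weight[//|lt_ts]].
by have := ltn_trans lt_st lt_ts; rewrite ltnn.
Qed.

Fact tamari_display : Order.disp_t. Proof. exact: Order.Disp tt tt. Qed.

HB.instance Definition _ m := Order.Le_isPOrder.Build tamari_display (Y m)
  (@connect0 _ _) (@tamari_anti m) (@connect_trans _ _).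

(** * Painted trees *)

Definition upper_order_ideal (m : nat) (t : btree) (P : {set 'I_m}) : bool :=
  [forall i in P, forall j : 'I_m, node_le t i j ==> (j \in P)].

(* A painted tree with [n] leaves, [n >= 1], as a pair [(t; P)]; the ordinal
   [i : 'I_n.-1] stands for the internal node numbered [i + 1] when counting
   from 1. *)
Record M (n : nat) := Painted {
  mval : Y n.-1 * {set 'I_n.-1};
  _ : upper_order_ideal mval.1 mval.2 }.

HB.instance Definition _ n := [isSub for @mval n].
HB.instance Definition _ n := [Finite of M n by <:].

Definition ptree n (p : M n) : Y n.-1 := (val p).1.
Definition painted n (p : M n) : {set 'I_n.-1} := (val p).2.

Definition painted_le n : rel (M n) :=
  fun p q => (ptree p <= ptree q) && (painted q \subset painted p).

Lemma painted_le_refl n : reflexive (@painted_le n).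
Proof. by move=> p; rewrite /painted_le lexx subxx. Qed.

Lemma painted_le_anti n : antisymmetric (@painted_le n).
Proof.
move=> p q /andP[/andP[le_pq sub_qp] /andP[le_qp sub_pq]]; apply: val_inj.
rewrite [LHS]surjective_pairing [RHS]surjective_pairing; congr pair.
  by apply: le_anti; rewrite [X in X && _]le_pq.
by apply/eqP; rewrite eqEsubset [X in X && _]sub_pq.
Qed.

Lemma painted_le_trans n : transitive (@painted_le n).
Proof.
move=> q p r /andP[le_pq sub_qp] /andP[le_qr sub_rq].
by rewrite /painted_le (le_trans le_pq le_qr) (subset_trans sub_rq sub_qp).
Qed.

HB.instance Definition _ n := Order.Le_isPOrder.Build tamari_display (M n)
  (@painted_le_refl n) (@painted_le_anti n) (@painted_le_trans n).

(* The trees left above the painted portion of [t], from left to right, where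
   [P] is the set of painted nodes and the nodes of [t] are numbered from [o]
   upwards.  Only meaningful when [P] is an upper order ideal. *)
Fixpoint cut_forest (P : pred nat) (o : nat) (t : btree) : seq btree :=
  if t is Node l r then
    if P (o + nodes l)%N
    then cut_forest P o l ++ cut_forest P (o + nodes l).+1 r
    else [:: t]
  else [:: Leaf].

Definition unpainted_forest n (p : M n) : seq btree :=
  cut_forest (mem [seq nat_of_ord i | i in painted p]) 0 (ptree p).

(** * Weighted trees *)

(* The weighted trees whose weights sum to [n >= 1], each corolla being drawn
   as the right comb with the same number of leaves. *)
Record CK (n : nat) := Weighted {
  ckval :> M n;
  _ : all is_right_comb (unpainted_forest ckval) }.

HB.instance Definition _ n := [isSub for @ckval n].
HB.instance Definition _ n := [Finite of CK n by <:].
HB.instance Definition _ n :=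
  [SubChoice_isSubPOrder of CK n by <: with tamari_display].

Definition weights n (x : CK n) : seq nat :=
  [seq leaves f | f <- unpainted_forest (val x)].

(** * Composition trees *)

(* Composition trees are identified with their sets of unpainted nodes. *)
Definition Q (n : nat) := {set 'I_n.-1}.

Section BooleanLattice.
Import Order.DefaultSetSubsetOrder.
HB.instance Definition _ n := Order.FinCTBDistrLattice.copy (Q n) {set 'I_n.-1}.
End BooleanLattice.

Lemma leEQ n (A B : Q n) : (A <= B) = (A \subset B).
Proof. by []. Qed.

(* w_1, w_1 + w_2, up to w_1 + ... + w_(k-1); the full sum is left out. *)
Definition proper_partial_sums (w : seq nat) : seq nat :=
  [seq sumn (take j w) | j <- iota 1 (size w).-1].

(* The composition tree with weights [w]: in the numbering from 1, its painted
   nodes are the proper partial sums of [w]. *)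
Definition composition_tree n (w : seq nat) : Q n :=
  [set i : 'I_n.-1 | i.+1 \notin proper_partial_sums w].

(* Replacing the painted portion by a corolla keeps only the weights. *)
Definition gamma_hat n (x : CK n) : Q n := composition_tree n (weights x).

(** * Interval retracts *)

Section IntervalRetract.
Context {d d' : Order.disp_t}.

Definition is_lattice (P : porderType d) : Prop :=
  forall x y : P,
    (exists m : P, forall z, (z <= m) = (z <= x) && (z <= y)) /\
    (exists j : P, forall z, (j <= z) = (x <= z) && (y <= z)).

Definition is_interval (P : porderType d) (A : P -> Prop) : Prop :=
  exists a b : P, a <= b /\ forall x, A x <-> a <= x <= b.

Definition interval_retract (P : finPOrderType d) (Q : porderType d')
    (f : P -> Q) : Prop :=
  [/\ is_lattice P,
      {homo f : x y / x <= y},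
      forall y : Q, exists x : P, f x = y,
      forall y : Q, is_interval (fun x : P => f x = y)
    & exists2 g : Q -> P, {homo g : x y / x <= y} & cancel g f].

End IntervalRetract.

(* Main.v *)
Require Import Defs.
From mathcomp Require Import all_boot all_order.
From mathcomp Require Import zify.
From Stdlib Require Import Relation_Operators.
Set Implicit Arguments.
Unset Strict Implicit.
Unset Printing Implicit Defensive.
Import Order.TTheory.

(** Write [f i] for the number of nodes in the right subtree of node [i] of a
binary tree.  Since node [i] and its right descendants are the nodes
[i, ..., i + f i], these intervals are nested, and every nested [f] comes from
exactly one tree.  In these coordinates the Tamari order is the pointwise order
([tamari_right_sizeP]): a rotation enlarges one value of [f], and conversely a
pointwise smaller tree can be rotated into a larger one.

A weighted tree becomes a pair of a nested [f] and a set of painted nodes.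
That the painted nodes form an upper order ideal and that the trees above them
are right combs amounts to two local conditions at each unpainted [i]
([weighted_onP]): node [i - 1], if there is one, has a right descendant, and all of
[i, ..., i + f i] are unpainted.  Both conditions, and nestedness, survive
pointwise minimum of [f] and union of the painted sets, so two weighted trees
have a meet ([CK_meet]); there is a largest weighted tree, the unpainted right
comb, and a finite meet-semilattice with a top is a lattice.

The proper partial sums of the weights are exactly the painted positions, so
[gamma_hat] is the complement of the painted set ([gamma_hatE]), visibly order
preserving.  For a fixed painted set the conditions confine [f] between two
extreme solutions.  The smallest has [f i] equal to the length of the unpainted
run that follows [i]: this is the left comb of right combs.  The largest has
the same values at the unpainted nodes and the greatest possible values at the
painted ones: this is the right comb of right combs.  Hence a fibre, which
consists of all trees with a given painted set, is the interval between the
two.  Unpainting more nodes lengthens the runs, so the smallest elements of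
the fibres form an order-preserving section. *)

(** * Right subtree sizes and nested functions *)

Fixpoint right_size (t : btree) (i : nat) : nat :=
  if t is Node l r then
    if i < nodes l then right_size l i
    else if i == nodes l then nodes r
    else right_size r (i - (nodes l).+1)
  else 0.

Lemma right_size_left l r i :
  i < nodes l -> right_size (Node l r) i = right_size l i.
Proof. by move=> /= ->. Qed.

Lemma right_size_root l r : right_size (Node l r) (nodes l) = nodes r.
Proof. by rewrite /= ltnn eqxx. Qed.

Lemma right_size_right l r i :
  right_size (Node l r) ((nodes l).+1 + i) = right_size r i.
Proof.
rewrite /= ifF; last by lia.
by rewrite ifF; [rewrite addKn | lia].
Qed.

(** Case analysis on the position of a node relative to the root, which replaces
the nested conditionals of [right_size] and [root_path] by separate goals. *)
Variant node_index_spec (l r : btree) : nat -> Prop :=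
  | IndexLeft i of i < nodes l : node_index_spec l r i
  | IndexRoot : node_index_spec l r (nodes l)
  | IndexRight i of i < nodes r : node_index_spec l r ((nodes l).+1 + i).

Lemma node_indexP l r i : i < nodes (Node l r) -> node_index_spec l r i.
Proof.
move=> /= lt_i; case: (ltngtP i (nodes l)) => [lt_il|lt_li|->].
- exact: IndexLeft.
- have -> : i = (nodes l).+1 + (i - (nodes l).+1) by lia.
  by apply: IndexRight; lia.
- exact: IndexRoot.
Qed.

Definition nested (m : nat) (f : nat -> nat) : Prop :=
  forall i, i < m ->
    i + f i < m /\ forall j, i <= j <= i + f i -> j + f j <= i + f i.

Lemma right_size_nested t : nested (nodes t) (right_size t).
Proof.
elim: t => [|l IHl r IHr] // i /node_indexP[{}i lt_i||{}i lt_i].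
- rewrite right_size_left //; have [lt_f nest] := IHl i lt_i.
  split=> [|j le_j]; first by rewrite /=; lia.
  by rewrite right_size_left; [exact: nest | lia].
- rewrite right_size_root; split=> [|j le_j]; first by rewrite /=; lia.
  have /node_indexP jP : j < nodes (Node l r) by rewrite /=; lia.
  case: j / jP le_j => [j lt_j le_j|_|j /IHr[lt_f _] _]; first by lia.
    by rewrite right_size_root.
  by rewrite right_size_right; lia.
- rewrite right_size_right; have [lt_f nest] := IHr i lt_i.
  split=> [|j le_j]; first by rewrite /=; lia.
  have -> : j = (nodes l).+1 + (j - (nodes l).+1) by lia.
  rewrite right_size_right.
  have := nest (j - (nodes l).+1); lia.
Qed.

Lemma right_size_lt t i : i < nodes t -> i + right_size t i < nodes t.
Proof. by case/right_size_nested. Qed.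

(** The root is found as the first [c] whose interval [c, ..., c + f c] reaches
the last node; by nestedness no interval that starts before [c] crosses [c], so
[f] splits into a left and a right part that are again nested. *)
Lemma nested_realised m f :
  nested m f ->
  exists2 t, nodes t = m & forall i, i < m -> right_size t i = f i.
Proof.
have [k] := ubnP m; elim: k m f => // k IHk [|m] f lt_mk nest_f.
  by exists Leaf.
have ex_root : exists i, (i <= m) && (i + f i == m).
  by exists m; have [] := nest_f m (ltnSn m); lia.
case: (ex_minnP ex_root) => c /andP[le_cm /eqP c_last] c_min.
have below i : i < c -> i + f i < c.
  move=> lt_ic; rewrite ltnNge; apply/negP => le_c.
  have [] := nest_f i (leq_trans lt_ic (leqW le_cm)) => ? /(_ c).
  by have := c_min i; lia.
have [|i lt_i|l nodes_l l_f] := IHk c f; first by lia.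
  split; first exact: below.
  by have [] := nest_f i (leq_trans lt_i (leqW le_cm)).
have [|i lt_i|r nodes_r r_f] := IHk (m - c) (fun i => f (c.+1 + i)); first by lia.
  have [|lt_f nest] := nest_f (c.+1 + i); first by lia.
  split=> [|j le_j]; first by lia.
  by have := nest (c.+1 + j); lia.
exists (Node l r) => [|i lt_i]; first by rewrite /=; lia.
have /node_indexP iP : i < nodes (Node l r) by rewrite /=; lia.
case: i / iP {lt_i} => [i lt_i||i lt_i].
- by rewrite right_size_left // l_f; lia.
- by rewrite right_size_root nodes_r nodes_l; lia.
- by rewrite right_size_right r_f; [rewrite nodes_l | lia].
Qed.

(** * The Tamari order is the pointwise order of right subtree sizes *)

Lemma rotations_right_size s t i :
  t \in rotations s -> right_size s i <= right_size t i.
Proof.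
elim: s t i => [|l IHl r IHr] t i //=; rewrite !mem_cat => /or3P[].
- case: l {IHl} => // a b; rewrite inE => /eqP-> /=.
  case: (ltngtP i (nodes a)) => [lt_ia|lt_ai|->].
  + by rewrite ifT //; lia.
  + case: (ltngtP i (nodes a + nodes b).+1) => [lt_i|lt_i|->].
    * by rewrite ifT //; lia.
    * rewrite ifF; last by lia.
      rewrite ifF; last by lia.
      by rewrite leq_eqVlt; apply/orP; left; apply/eqP; congr right_size; lia.
    * rewrite ifF; last by lia.
      by rewrite ifT //; lia.
  + by rewrite ifT; lia.
- case/mapP=> l' l'P ->; rewrite /= (rotations_nodes l'P).
  by case: ifP => // _; exact: IHl.
- case/mapP=> r' r'P ->; rewrite /= (rotations_nodes r'P).
  by case: ifP => // _; case: ifP => // _; exact: IHr.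
Qed.

(** The rotation order on bare trees, where the number of nodes is not part of
the type and subtrees can be rotated independently. *)
Definition rotates : btree -> btree -> Prop :=
  clos_refl_trans btree (fun s t => t \in rotations s).

Lemma rotates_nodes s t : rotates s t -> nodes t = nodes s.
Proof.
by elim=> {s t} [s t /rotations_nodes| |s u t _ e1 _ e2] //; rewrite e2.
Qed.

Lemma rotates_Node l l' r r' :
  rotates l l' -> rotates r r' -> rotates (Node l r) (Node l' r').
Proof.
move=> rot_l rot_r; apply: (@rt_trans _ _ _ (Node l' r)).
  elim: rot_l => {l l'} [l l' lP|l|l l1 l' _ IH1 _ IH2].
  - by apply: rt_step; rewrite /= !mem_cat map_f ?orbT.
  - exact: rt_refl.
  - exact: rt_trans IH1 IH2.
elim: rot_r => {r r'} [r r' rP|r|r r1 r' _ IH1 _ IH2].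
- by apply: rt_step; rewrite /= !mem_cat [in X in _ || X]map_f ?orbT.
- exact: rt_refl.
- exact: rt_trans IH1 IH2.
Qed.

Lemma rotates_root a b c : rotates (Node (Node a b) c) (Node a (Node b c)).
Proof. by apply: rt_step; rewrite /= inE eqxx. Qed.

(** The tree induced on the first [a] nodes, obtained by truncating every
right subtree at node [a]. *)
Fixpoint prefix_tree (a : nat) (t : btree) : btree :=
  if t is Node l r then
    if a <= nodes l then prefix_tree a l
    else Node l (prefix_tree (a - (nodes l).+1) r)
  else Leaf.

Lemma nodes_prefix_tree a t : nodes (prefix_tree a t) = minn a (nodes t).
Proof.
elim: t a => [|l IHl r IHr] a /=; first by rewrite minn0.
by case: leqP => le_a /=; rewrite ?IHl ?IHr; lia.
Qed.

Lemma right_size_prefix_tree a t i :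
  i < a <= nodes t ->
  right_size (prefix_tree a t) i = minn (right_size t i) (a - i.+1).
Proof.
elim: t a i => [|l IHl r IHr] a i; first by case: a => [|a] /andP[].
move=> /andP[lt_ia le_a]; rewrite [prefix_tree _ _]/=; case: leqP => [le_al|lt_la].
  by rewrite IHl ?lt_ia // right_size_left //; lia.
have /node_indexP iP : i < nodes (Node l r) by lia.
rewrite /= in le_a.
case: i / iP lt_ia => [i lt_i lt_ia|lt_ia|i lt_i lt_ia].
- by rewrite !right_size_left //; have := right_size_lt lt_i; lia.
- by rewrite !right_size_root nodes_prefix_tree; lia.
- by rewrite !right_size_right IHr; lia.
Qed.

(** The root of [s] has the maximal possible right subtree, so in [t] it lies on
the right spine, weakly to the right of the root of [t].  If the two roots
agree, the subtrees are compared separately.  Otherwise let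
[t = Node l' r'] and let [q] be the part of [r'] to the left of the root of
[s].  The left subtree of [s] is below [Node l' q], a single rotation at the
root exchanges [Node (Node l' q) r] for [Node l' (Node q r)], and [Node q r] is
below [r']. *)
Lemma right_size_rotates s t :
  nodes s = nodes t ->
  (forall i, i < nodes t -> right_size s i <= right_size t i) ->
  rotates s t.
Proof.
have [m] := ubnP (nodes t); elim: m s t => // m IHm [|l r] [|l' r'] // lt_tm.
  by move=> _ _; exact: rt_refl.
move=> eq_nodes le_st; have /= eq_n := eq_nodes; rewrite /= in lt_tm.
have le_root : nodes l' <= nodes l.
  rewrite leqNgt; apply/negP => lt_l.
  have /le_st : nodes l < nodes (Node l' r') by rewrite /=; lia.
  rewrite right_size_root right_size_left //.
  by have := right_size_lt lt_l; lia.
case: (ltngtP (nodes l') (nodes l)) le_root => // [lt_l|eq_l] _; last first.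
  apply: rotates_Node; apply: IHm; try lia.
  - move=> i lt_i; have /le_st : i < nodes (Node l' r') by rewrite /=; lia.
    by rewrite !right_size_left // -eq_l.
  - move=> i lt_i.
    have /le_st : (nodes l').+1 + i < nodes (Node l' r') by rewrite /=; lia.
    by rewrite {1}eq_l !right_size_right.
set a := nodes l - (nodes l').+1; set q := prefix_tree a r'.
have nodes_q : nodes q = a by rewrite nodes_prefix_tree; lia.
apply: (@rt_trans _ _ _ (Node (Node l' q) r)).
  apply: rotates_Node (rt_refl _ _ _); apply: IHm;
    rewrite ?[nodes (Node _ _)]/= ?nodes_q.
  + by lia.
  + by lia.
  move=> i lt_i; have lt_il : i < nodes l by lia.
  have := right_size_lt lt_il.
  have : i < nodes (Node l' q) by rewrite /= nodes_q; lia.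
  have /le_st : i < nodes (Node l' r') by rewrite /=; lia.
  rewrite (right_size_left _ lt_il) => le_i /node_indexP-iP.
  case: i / iP lt_i le_i lt_il => [i lt_i||i lt_i] _ le_i lt_il lt_f.
  + by move: le_i; rewrite !right_size_left.
  + (* The right subtree of this node stays within the left subtree of [s],
       which ends exactly where [q] ends. *)
    by rewrite right_size_root nodes_q; lia.
  + by move: le_i; rewrite !right_size_right right_size_prefix_tree; lia.
apply: rt_trans (rotates_root _ _ _) _.
apply: rotates_Node (rt_refl _ _ _) _; apply: IHm.
- by lia.
- by rewrite /= nodes_q; lia.
move=> i lt_i.
have /node_indexP iP : i < nodes (Node q r) by rewrite /= nodes_q; lia.
have := le_st ((nodes l').+1 + i); rewrite right_size_right.
case: i / iP lt_i => [i lt_i||i lt_i] lt_ir'.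
- by move=> _; rewrite right_size_left // right_size_prefix_tree; lia.
- rewrite right_size_root nodes_q => le_r.
  have e : (nodes l').+1 + a = nodes l by lia.
  by move: le_r; rewrite e right_size_root; apply; rewrite /=; lia.
- rewrite right_size_right nodes_q => le_r.
  have e : (nodes l').+1 + (a.+1 + i) = (nodes l).+1 + i by lia.
  by move: le_r; rewrite e right_size_right; apply; rewrite /=; lia.
Qed.

Lemma rotates_tamari m (s t : Y m) : rotates s t -> tamari s t.
Proof.
suff gen u v : rotates u v ->
    forall s t : Y m, val s = u -> val t = v -> tamari s t.
  by move=> rot; exact: gen rot s t erefl erefl.
elim=> {u v s t}.
- by move=> u v rot s t eu ev; apply: connect1; rewrite eu ev.
- by move=> u s t <- /val_inj->; apply: connect0.
- move=> u w v rot1 IH1 _ IH2 s t eu ev.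
  have mw : nodes w == m by rewrite (rotates_nodes rot1) -eu (valP s).
  exact: connect_trans (IH1 s (YTree mw) eu erefl) (IH2 (YTree mw) t erefl ev).
Qed.

Lemma tamari_right_sizeP m (s t : Y m) :
  reflect (forall i, i < m -> right_size s i <= right_size t i) (s <= t)%O.
Proof.
apply: (iffP idP) => [/connectP[p]|le_st].
  elim: p s => [|u p IHp] s /=; first by move=> _ -> i.
  case/andP=> /rotations_right_size le_su /IHp IH /IH le_ut i lt_i.
  exact: leq_trans (le_su i) (le_ut i lt_i).
apply: rotates_tamari; apply: right_size_rotates.
  by rewrite (eqP (valP s)) (eqP (valP t)).
by move=> i; rewrite (eqP (valP t)); exact: le_st.
Qed.

(** * Weighted trees in terms of right subtree sizes *)

Lemma root_path_left l r i :
  i < nodes l -> root_path (Node l r) i = nodes l :: root_path l i.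
Proof. by move=> /= ->. Qed.

Lemma root_path_right l r i :
  root_path (Node l r) ((nodes l).+1 + i) =
  nodes l :: [seq (nodes l).+1 + j | j <- root_path r i].
Proof.
rewrite /= ifF; last by lia.
by rewrite ifF; [rewrite addKn | lia].
Qed.

Lemma root_path_lt t i j : j \in root_path t i -> j < nodes t.
Proof.
elim: t i j => [|l IHl r IHr] i j //=; rewrite inE => /predU1P[->|]; first by lia.
case: ifP => _ => [/IHl|]; first by lia.
by case: ifP => // _ /mapP[j' /IHr lt_j' ->]; lia.
Qed.

(** Upper order ideals with the offset convention of [cut_forest], so that the
condition can be passed to subtrees. *)
Definition ideal_on (P : pred nat) (o : nat) (t : btree) : Prop :=
  forall i, i < nodes t -> P (o + i) ->
    forall j, j \in root_path t i -> P (o + j).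

Lemma ideal_on_Node (P : pred nat) o l r : P (o + nodes l) ->
  ideal_on P o (Node l r) <->
  ideal_on P o l /\ ideal_on P (o + nodes l).+1 r.
Proof.
move=> Pk; split=> [id_t|[id_l id_r] i /node_indexP-iP].
- split=> i lt_i Pi j j_i.
  + apply: (id_t i) => //; first by rewrite /=; lia.
    by rewrite root_path_left // inE j_i orbT.
  + have -> : (o + nodes l).+1 + j = o + ((nodes l).+1 + j) by lia.
    apply: (id_t ((nodes l).+1 + i)); first by rewrite /=; lia.
      by have -> : o + ((nodes l).+1 + i) = (o + nodes l).+1 + i by lia.
    by rewrite root_path_right inE map_f ?orbT.
- case: i / iP => [i lt_i||i lt_i] Pi j.
  + by rewrite root_path_left // inE => /predU1P[-> //|/id_l]; exact.
  + by rewrite /= ltnn eqxx inE => /eqP->.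
  + rewrite root_path_right inE => /predU1P[-> //|/mapP[j' j'P ->]].
    have -> : o + ((nodes l).+1 + j') = (o + nodes l).+1 + j' by lia.
    apply: id_r j'P => //.
    by have -> : (o + nodes l).+1 + i = o + ((nodes l).+1 + i) by lia.
Qed.

Lemma ideal_on_unpainted_root (P : pred nat) o l r :
  ~~ P (o + nodes l) -> ideal_on P o (Node l r) ->
  forall i, i < nodes (Node l r) -> ~~ P (o + i).
Proof.
move=> nPk id_t i lt_i; apply: contra nPk => Pi.
by apply: id_t lt_i Pi _ _; rewrite /= mem_head.
Qed.

(** The first conclusion says that node [i - 1] has a right descendant. It
keeps the left subtree of an unpainted node empty: the last node of a nonempty
left subtree has no right descendant.  The second says that what lies to the
right of an unpainted node inside its subtree is unpainted. *)
Definition weighted_on (m : nat) (f : nat -> nat) (P : pred nat) : Prop :=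
  forall i, i < m -> ~~ P i ->
    (0 < i -> 0 < f i.-1) /\ forall j, i <= j <= i + f i -> ~~ P j.

Lemma weighted_on_Node (P : pred nat) o l r : P (o + nodes l) ->
  weighted_on (nodes (Node l r)) (right_size (Node l r)) (fun i => P (o + i)) <->
  weighted_on (nodes l) (right_size l) (fun i => P (o + i)) /\
  weighted_on (nodes r) (right_size r) (fun i => P ((o + nodes l).+1 + i)).
Proof.
move=> Pk; split=> [w_t|[w_l w_r] i /node_indexP-iP].
- split=> i lt_i nPi.
  + have [|pos below] := w_t i _ nPi; first by rewrite /=; lia.
    split=> [i_gt0|j]; last by rewrite -(right_size_left r lt_i); exact: below.
    by rewrite -(right_size_left r); [exact: pos | lia].
  + have e j : (o + nodes l).+1 + j = o + ((nodes l).+1 + j) by lia.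
    have [||pos below] := w_t ((nodes l).+1 + i); first by rewrite /=; lia.
      by rewrite -e.
    rewrite right_size_right in below; split=> [i_gt0|j le_j].
      by rewrite -(right_size_right l); have -> : (nodes l).+1 + i.-1 =
        ((nodes l).+1 + i).-1 by [lia]; apply: pos.
    by rewrite e; apply: below; lia.
- case: i / iP => [i lt_i||i lt_i] nPi.
  + rewrite (right_size_left r lt_i); have [pos below] := w_l i lt_i nPi.
    split=> // i_gt0; rewrite right_size_left; first exact: pos.
    by lia.
  + by rewrite Pk in nPi.
  + have e j : o + ((nodes l).+1 + j) = (o + nodes l).+1 + j by lia.
    rewrite e in nPi; have [pos below] := w_r i lt_i nPi.
    rewrite right_size_right; split=> [_|j le_j].
      case: i lt_i pos {below nPi} => [|i] lt_i pos.
        by rewrite addn0 [_.-1]/= right_size_root.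
      have -> : ((nodes l).+1 + i.+1).-1 = (nodes l).+1 + i by lia.
      by rewrite right_size_right; apply: pos.
    have -> : j = (nodes l).+1 + (j - (nodes l).+1) by lia.
    by rewrite e; apply: below; lia.
Qed.

Lemma right_comb_Node l r :
  is_right_comb (Node l r) = (l == Leaf) && is_right_comb r.
Proof.
apply/eqP/andP=> /= [[-> ->]|[/eqP-> /eqP e]]; last by rewrite add0n -e.
by rewrite eqxx /is_right_comb; split=> //; elim: (_ + _) => //= k /eqP <-.
Qed.

Lemma right_size_right_comb t i :
  is_right_comb t -> right_size t i = nodes t - i.+1.
Proof.
elim: t i => [|l _ r IHr] i //; rewrite right_comb_Node => /andP[/eqP-> rc_r].
case: i => [|i]; first by rewrite /=; lia.
by rewrite -[i.+1]/((nodes Leaf).+1 + i) right_size_right IHr //=; lia.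
Qed.

(** At a painted root both sides split into conditions on the two subtrees.  At
an unpainted root the left-hand side says that the whole tree is an unpainted
right comb.  The local conditions force the same: the left subtree is empty,
every node is a right descendant of the root, and induction applies to the
right subtree. *)
Lemma weighted_onP (P : pred nat) o t :
  ideal_on P o t /\ all is_right_comb (cut_forest P o t) <->
  weighted_on (nodes t) (right_size t) (fun i => P (o + i)).
Proof.
elim: t o => [|l IHl r IHr] o; first by split=> // _; split=> // i.
rewrite [cut_forest _ _ _]/=; case: ifPn => [Pk|nPk].
  rewrite ideal_on_Node // weighted_on_Node // -IHl -IHr all_cat.
  split=> [[[id_l id_r] /andP[rc_l rc_r]]|[[id_l rc_l] [id_r rc_r]]] //.
  by rewrite rc_l rc_r.
split=> [[id_t]|w_t].
  move/andP=> [rc_t _] i lt_i _; rewrite !right_size_right_comb //.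
  split=> [|j le_j]; first by lia.
  by apply: (ideal_on_unpainted_root nPk id_t); lia.
have lt_k : nodes l < nodes (Node l r) by rewrite /=; lia.
have [pos below] := w_t _ lt_k nPk; rewrite right_size_root in below.
have l0 : l = Leaf.
  (* The last node of a nonempty left subtree would have an empty right
     subtree, although the unpainted root comes just after it. *)
  have [l_0|l_gt0] := posnP (nodes l); first by case: (l) l_0.
  have := pos l_gt0; have := @right_size_lt l (nodes l).-1.
  by rewrite right_size_left; lia.
subst l; rewrite /= add0n in lt_k below nPk.
have nP i : i < nodes (Node Leaf r) -> ~~ P (o + i).
  by rewrite /= => lt_i; apply: below; lia.
split; first by move=> i lt_i Pi; rewrite (negPf (nP i lt_i)) in Pi.
rewrite /= andbT right_comb_Node eqxx /=.
have /IHr[_] : weighted_on (nodes r) (right_size r) (fun i => P (o.+1 + i)).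
  move=> i lt_i _; split=> [i_gt0|j le_j].
    have [||pos' _] := w_t i.+1; first by rewrite /=; lia.
      by apply: nP; rewrite /=; lia.
    have := pos' isT; rewrite -[i.+1.-1](_ : (nodes Leaf).+1 + i.-1 = _).
      by rewrite right_size_right.
    by rewrite /=; lia.
  rewrite addSnnS; apply: nP => /=.
  by have := right_size_lt lt_i; lia.
case: r nP {IHr w_t lt_k below pos} => // a b nP.
rewrite [cut_forest _ _ _]/= ifN; first by rewrite /= andbT.
have -> : o.+1 + nodes a = o + (nodes a).+1 by lia.
by apply: nP; rewrite /=; lia.
Qed.

(** * The weights determine the painted nodes *)

Lemma proper_partial_sums_cat w1 w2 :
  0 < size w1 -> 0 < size w2 ->
  proper_partial_sums (w1 ++ w2) =
  proper_partial_sums w1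
    ++ sumn w1 :: [seq sumn w1 + s | s <- proper_partial_sums w2].
Proof.
move=> w1_gt0 w2_gt0; rewrite /proper_partial_sums size_cat.
have -> : (size w1 + size w2).-1 = (size w1).-1 + (size w2).-1.+1 by lia.
rewrite iotaD map_cat add1n prednK // [iota _ _.+1]/= [map _ (_ :: _)]/=.
congr (_ ++ _ :: _).
- apply/eq_in_map => j; rewrite mem_iota => lt_j.
  by rewrite takel_cat //; lia.
- by rewrite take_size_cat.
- rewrite -map_comp -[(size w1).+1]addn1 iotaDl -map_comp.
  by apply: eq_map => j /=; rewrite takeD take_size_cat // drop_size_cat // sumn_cat.
Qed.

Lemma leaves_nodes t : leaves t = (nodes t).+1.
Proof. by elim: t => //= l -> r ->; rewrite addnS. Qed.

Lemma cut_forest_size P o t : 0 < size (cut_forest P o t).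
Proof.
by elim: t o => //= l IHl r _ o; case: ifP => //; rewrite size_cat ltn_addr.
Qed.

Lemma sumn_cut_forest P o t :
  sumn [seq leaves f | f <- cut_forest P o t] = (nodes t).+1.
Proof.
elim: t o => [|l IHl r IHr] o //=; case: ifP => _.
  by rewrite map_cat sumn_cat IHl IHr addnS.
by rewrite /= !leaves_nodes; lia.
Qed.

(** A painted root separates the forests of its two subtrees, and it sits at
the sum of the weights on its left, because a tree has one more leaf than
nodes. *)
Lemma mem_partial_sums (P : pred nat) o t i :
  ideal_on P o t ->
  (i \in proper_partial_sums [seq leaves f | f <- cut_forest P o t]) =
  (0 < i <= nodes t) && P (o + i.-1).
Proof.
elim: t o i => [|l IHl r IHr] o i; first by case: i.
rewrite [cut_forest _ _ _]/=.
case: ifPn => [Pk /ideal_on_Node-/(_ Pk)[id_l id_r]|nPk id_t].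
  rewrite map_cat proper_partial_sums_cat ?size_map ?cut_forest_size //.
  rewrite mem_cat inE sumn_cut_forest IHl //.
  have -> : (i \in [seq (nodes l).+1 + s | s <- proper_partial_sums
      [seq leaves f | f <- cut_forest P (o + nodes l).+1 r]]) =
      ((nodes l).+1 < i <= nodes (Node l r)) && P (o + i.-1).
    apply/mapP/idP => [[s]|/andP[/andP[lt_i le_i] Pi]].
      rewrite IHr // => /andP[/andP[s_gt0 le_s] Ps] ->.
      have -> : o + ((nodes l).+1 + s).-1 = (o + nodes l).+1 + s.-1 by lia.
      by rewrite Ps /=; lia.
    exists (i - (nodes l).+1); last by lia.
    rewrite IHr //.
    have -> : (o + nodes l).+1 + (i - (nodes l).+1).-1 = o + i.-1 by lia.
    by move: le_i => /=; rewrite Pi; lia.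
  rewrite /=; case: (ltngtP i (nodes l).+1) => [lt_i|lt_i|->].
  - by case: (P _); rewrite ?andbT ?andbF; lia.
  - by case: (P _); rewrite ?andbT ?andbF; lia.
  - by rewrite /= Pk; lia.
rewrite in_nil; apply/esym/negP => /andP[/andP[i_gt0 le_i]]; apply/negP.
by apply: (ideal_on_unpainted_root nPk id_t); lia.
Qed.

(** The form in which [unpainted_forest] hands the painted set to
[cut_forest]. *)
Definition nat_mem m (S : {set 'I_m}) : pred nat :=
  mem [seq nat_of_ord i | i in S].

Lemma nat_mem_ord m (S : {set 'I_m}) (i : 'I_m) : nat_mem S i = (i \in S).
Proof. by rewrite /nat_mem /= mem_image //; exact: ord_inj. Qed.

Lemma nat_memU m (S T : {set 'I_m}) i :
  nat_mem (S :|: T) i = nat_mem S i || nat_mem T i.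
Proof.
apply/imageP/orP=> [[j]|[]/imageP[j jS ->]].
- by rewrite inE => /orP[] jS ->; [left|right]; apply: image_f.
- by exists j; rewrite // inE jS.
- by exists j; rewrite // inE jS orbT.
Qed.

Lemma nat_mem0 m i : nat_mem (set0 : {set 'I_m}) i = false.
Proof. by apply/imageP=> -[j]; rewrite inE. Qed.

Lemma nat_mem_sub m (S T : {set 'I_m}) i :
  S \subset T -> nat_mem S i -> nat_mem T i.
Proof. by move/subsetP=> sST /imageP[j /sST jT ->]; apply: image_f. Qed.

Lemma upper_order_idealP m (t : Y m) (S : {set 'I_m}) :
  reflect (ideal_on (nat_mem S) 0 t) (upper_order_ideal t S).
Proof.
have nt := eqP (valP t); apply: (iffP forall_inP) => [id_S i|id_S i iS].
  rewrite nt !add0n => lt_i; rewrite -[i]/(nat_of_ord (Ordinal lt_i)) nat_mem_ord.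
  move=> /id_S/forallP id_i j j_i.
  have lt_j : j < m.
    by rewrite -nt; exact: root_path_lt j_i.
  rewrite -[j]/(nat_of_ord (Ordinal lt_j)) nat_mem_ord.
  exact: (implyP (id_i (Ordinal lt_j))).
apply/forallP=> j; apply/implyP=> j_i; rewrite -nat_mem_ord.
by apply: (id_S i); rewrite ?nt ?ltn_ord ?nat_mem_ord.
Qed.

(** * Coordinates on the weighted trees *)

Lemma CK_nested n (x : CK n) : nested n.-1 (right_size (ptree x)).
Proof.
by have nx := eqP (valP (ptree x)); rewrite -[X in nested X]nx;
  exact: right_size_nested.
Qed.

Lemma CK_weighted_on n (x : CK n) :
  weighted_on n.-1 (right_size (ptree x)) (nat_mem (painted x)).
Proof.
have nx := eqP (valP (ptree x)); rewrite -[X in weighted_on X]nx.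
apply/(weighted_onP (nat_mem (painted x)) 0); split; last exact: valP x.
exact/upper_order_idealP/(valP (ckval x)).
Qed.

(** Together with [CK_nested] and [CK_weighted_on], this identifies the weighted
trees with the pairs of a function and a painted set that satisfy the local
conditions; it is the only way weighted trees are built below. *)
Lemma CK_realised n f (S : {set 'I_n.-1}) :
  nested n.-1 f -> weighted_on n.-1 f (nat_mem S) ->
  exists x : CK n, painted x = S
    /\ forall i, i < n.-1 -> right_size (ptree x) i = f i.
Proof.
move=> /nested_realised[t /eqP mt tf] w_f.
have [id_t rc_t] : ideal_on (nat_mem S) 0 t /\
    all is_right_comb (cut_forest (nat_mem S) 0 t).
  apply/weighted_onP=> i; rewrite (eqP mt) => lt_i nPi.
  have [pos below] := w_f i lt_i nPi; rewrite (tf i lt_i); split=> // i_gt0.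
  by rewrite tf; [exact: pos | lia].
have id_S : upper_order_ideal (YTree mt) S by apply/upper_order_idealP.
by exists (@Weighted n (@Painted n (YTree mt, S) id_S) rc_t).
Qed.

Lemma CK_leP n (x y : CK n) :
  reflect ((forall i, i < n.-1 -> right_size (ptree x) i <= right_size (ptree y) i)
           /\ painted y \subset painted x)
    (x <= y)%O.
Proof.
by apply: (iffP andP) => -[/tamari_right_sizeP].
Qed.

Lemma gamma_hatE n (x : CK n) : gamma_hat x = ~: painted x.
Proof.
have id_x : ideal_on (nat_mem (painted x)) 0 (ptree x).
  exact/upper_order_idealP/(valP (ckval x)).
apply/setP=> i; rewrite !inE -nat_mem_ord; congr (~~ _).
by rewrite [LHS](mem_partial_sums _ id_x) (eqP (valP (ptree x))) ltn_ord.
Qed.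

Lemma gamma_hat_painted n (x : CK n) (A : Q n) :
  gamma_hat x = A <-> painted x = ~: A.
Proof. by rewrite gamma_hatE; split=> [<-|->]; rewrite setCK. Qed.

(** * The extreme trees with a given painted set *)

Definition run_after (m : nat) (P : pred nat) (i : nat) : nat :=
  find P (iota i.+1 (m - i.+1)).

Lemma run_after_lt m P i : i < m -> i + run_after m P i < m.
Proof.
move=> lt_i; have := find_size P (iota i.+1 (m - i.+1)).
by rewrite size_iota /run_after; lia.
Qed.

Lemma run_after_unpainted m (P : pred nat) i j :
  i < j <= i + run_after m P i -> ~~ P j.
Proof.
rewrite /run_after => /andP[lt_ij le_j].
have lt_find : j - i.+1 < find P (iota i.+1 (m - i.+1)) by lia.
have := before_find 0 lt_find.
have := find_size P (iota i.+1 (m - i.+1)); rewrite size_iota => le_find.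
rewrite nth_iota; last by lia.
by rewrite subnKC // => ->.
Qed.

Lemma run_after_max m (P : pred nat) i k :
  k < m -> (forall j, i < j <= k -> ~~ P j) -> k <= i + run_after m P i.
Proof.
move=> lt_k nP; rewrite leqNgt; apply/negP => lt_run.
have := find_size P (iota i.+1 (m - i.+1)); rewrite size_iota => le_find.
have lt_find : run_after m P i < m - i.+1 by rewrite /run_after in lt_run *; lia.
have hasP : has P (iota i.+1 (m - i.+1)) by rewrite has_find size_iota.
have := nth_find 0 hasP; rewrite -/(run_after m P i) nth_iota //.
by apply/negP/nP; lia.
Qed.

(** In this lemma and the next, [run_after_max] reduces an inequality between
runs to checking that an interval of nodes is unpainted. *)
Lemma run_after_nested m P : nested m (run_after m P).
Proof.
move=> i lt_i; have lt_run := run_after_lt P lt_i; split=> // j le_j.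
have lt_j : j < m by lia.
apply: run_after_max => [|l le_l]; first exact: run_after_lt.
have [le_li|lt_li] := leqP l (i + run_after m P i).
  by apply: (@run_after_unpainted m P i); lia.
by apply: (@run_after_unpainted m P j); lia.
Qed.

Lemma run_after_weighted_on m P : weighted_on m (run_after m P) P.
Proof.
move=> i lt_i nPi; split=> [i_gt0|j le_j].
  have : i <= i.-1 + run_after m P i.-1; last by lia.
  by apply: run_after_max => // j le_j; have -> : j = i by lia.
case: (ltngtP i j) => [lt_ij|lt_ji|<- //]; last by lia.
by apply: (@run_after_unpainted m P i); lia.
Qed.

(** Each unpainted node [k.+1] of the run forces node [k] to have a right
descendant; by nestedness the subtree of [i] then extends from [k] to
[k.+1]. *)
Lemma run_after_min m f (P : pred nat) i :
  nested m f -> weighted_on m f P -> i < m -> run_after m P i <= f i.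
Proof.
move=> nest_f w_f lt_i; rewrite -(leq_add2l i).
have lt_run := run_after_lt P lt_i.
suff le_k k : k <= run_after m P i -> i + k <= i + f i by exact: le_k.
elim: k => [|k IHk] le_k; first by lia.
have [//||pos _] := w_f (i + k.+1); first by lia.
  by apply: (@run_after_unpainted m P i); lia.
have [_ /(_ (i + k))] := nest_f i lt_i.
by have := IHk; have := pos; rewrite addnS /=; lia.
Qed.

(** At a painted node the painted part imposes no bound, so the right subtree
may take all the remaining nodes. *)
Definition run_or_rest (m : nat) (P : pred nat) (i : nat) : nat :=
  if P i then m - i.+1 else run_after m P i.

Lemma run_or_rest_nested m P : nested m (run_or_rest m P).
Proof.
move=> i lt_i; have [lt_run nest] := run_after_nested P lt_i.
have lt_rest j : j < m -> j + run_or_rest m P j < m.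
  by move=> lt_j; rewrite /run_or_rest; case: ifP => _; [lia | exact: run_after_lt].
split=> [|j]; first exact: lt_rest.
rewrite {1 3}/run_or_rest; case: ifPn => [_|nPi] le_j.
  by have := lt_rest j; lia.
have [_ below] := run_after_weighted_on lt_i nPi.
by rewrite /run_or_rest (negPf (below j le_j)); exact: nest.
Qed.

Lemma run_or_rest_weighted_on m P : weighted_on m (run_or_rest m P) P.
Proof.
move=> i lt_i nPi; have [pos below] := run_after_weighted_on lt_i nPi.
rewrite /run_or_rest (negPf nPi); split=> // i_gt0.
by case: ifP => _; [lia | exact: pos].
Qed.

Lemma run_or_rest_max m f (P : pred nat) i :
  nested m f -> weighted_on m f P -> i < m -> f i <= run_or_rest m P i.
Proof.
move=> nest_f w_f lt_i; have [lt_f _] := nest_f i lt_i.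
rewrite /run_or_rest; case: ifPn => [_|nPi]; first by lia.
have [_ below] := w_f i lt_i nPi.
rewrite -(leq_add2l i); apply: run_after_max => // j le_j; apply: below; lia.
Qed.

(** * The lattice of weighted trees *)

(** The local conditions have the form of implications from unpainted nodes, and
the subtrees only shrink under pointwise minimum, so they are inherited by the
minimum with the nodes unpainted in both trees. *)
Lemma CK_meet n (x y : CK n) :
  exists m : CK n, forall z, (z <= m)%O = (z <= x)%O && (z <= y)%O.
Proof.
have nest_x := CK_nested x; have nest_y := CK_nested y.
have w_x := @CK_weighted_on n x; have w_y := @CK_weighted_on n y.
set f := fun i => minn (right_size (ptree x) i) (right_size (ptree y) i).
have nest_f : nested n.-1 f.
  move=> i lt_i; rewrite /f.
  have [lt_x {}nest_x] := nest_x i lt_i; have [_ {}nest_y] := nest_y i lt_i.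
  split=> [|j le_j]; first by lia.
  by have := nest_x j; have := nest_y j; lia.
have w_f : weighted_on n.-1 f (nat_mem (painted x :|: painted y)).
  move=> i lt_i; rewrite nat_memU negb_or => /andP[nPx nPy].
  have [pos_x below_x] := w_x i lt_i nPx; have [pos_y below_y] := w_y i lt_i nPy.
  rewrite /f; split=> [i_gt0|j le_j]; first by rewrite leq_min pos_x ?pos_y.
  by rewrite nat_memU negb_or below_x ?below_y //; lia.
have [m [paint_m size_m]] := CK_realised nest_f w_f.
exists m => z; apply/CK_leP/andP; rewrite paint_m subUset.
  case=> le_zm /andP[sub_x sub_y]; split; apply/CK_leP; split=> // i lt_i.
    by have := le_zm i lt_i; rewrite size_m // /f; lia.
  by have := le_zm i lt_i; rewrite size_m // /f; lia.
case=> /CK_leP[le_zx ->] /CK_leP[le_zy ->]; split=> // i lt_i.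
by rewrite size_m // leq_min le_zx ?le_zy.
Qed.

Lemma CK_top n : exists t : CK n, forall x, (x <= t)%O.
Proof.
have [||t [paint_t size_t]] := @CK_realised n (fun i => n.-1 - i.+1) set0.
- by move=> i lt_i; split=> [|j]; lia.
- by move=> i lt_i _; split=> [|j _]; [lia | rewrite nat_mem0].
exists t => x; apply/CK_leP; rewrite paint_t sub0set; split=> // i lt_i.
by rewrite size_t //; have [] := CK_nested x lt_i; lia.
Qed.

(** The join of [x] and [y] is the meet of all their upper bounds; the top
element supplies the empty meet. *)
Lemma meets_top_lattice d (P : finPOrderType d) :
  (forall x y : P, exists m, forall z, (z <= m)%O = (z <= x)%O && (z <= y)%O) ->
  (exists t : P, forall x, (x <= t)%O) ->
  is_lattice P.
Proof.
move=> meet [t le_t] x y; split; first exact: meet.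
have big_meet (s : seq P) : exists m, forall z, (z <= m)%O = all (>= z)%O s.
  elim: s => [|a s [m le_m]]; first by exists t => z; rewrite le_t.
  by have [m' le_m'] := meet a m; exists m' => z; rewrite le_m' le_m.
have [j le_j] := big_meet (enum [pred u | (x <= u)%O && (y <= u)%O]).
exists j => z; apply/idP/andP=> [le_jz|[le_xz le_yz]].
  have [le_xj le_yj] : (x <= j)%O /\ (y <= j)%O.
    by rewrite !le_j; split; apply/allP=> u; rewrite mem_enum inE => /andP[].
  by rewrite (le_trans le_xj le_jz) (le_trans le_yj le_jz).
have := le_j j; rewrite lexx => /esym/allP/(_ z); apply.
by rewrite mem_enum inE le_xz le_yz.
Qed.

(** * The interval retract *)

Theorem theorem3p5 (n : nat) (n_ge1 : 1 <= n) : interval_retract (@gamma_hat n).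
Proof.
have fibre_min (A : Q n) := CK_realised
  (run_after_nested (nat_mem (~: A))) (run_after_weighted_on (P := nat_mem (~: A))).
have [g g_spec] := fin_all_exists fibre_min.
have gK : cancel g (@gamma_hat n).
  by move=> A; apply/gamma_hat_painted; have [] := g_spec A.
split.
- by apply: meets_top_lattice; [exact: CK_meet | exact: CK_top].
- by move=> x y /CK_leP[_ sub]; rewrite leEQ !gamma_hatE setCS.
- by move=> A; exists (g A).
- move=> A.
  have [b [paint_b size_b]] := CK_realised (run_or_rest_nested (nat_mem (~: A)))
    (run_or_rest_weighted_on (P := nat_mem (~: A))).
  have [paint_a size_a] := g_spec A.
  have bounds x : gamma_hat x = A -> (g A <= x <= b)%O.
    move/gamma_hat_painted=> paint_x.
    have nest_x := CK_nested x; have := @CK_weighted_on n x; rewrite paint_x => w_x.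
    apply/andP; split; apply/CK_leP; rewrite paint_x ?paint_a ?paint_b;
      split=> // i lt_i.
      by rewrite size_a //; exact: run_after_min.
    by rewrite size_b //; exact: run_or_rest_max.
  (* An order relation between trees reverses inclusion of the painted sets, so
     a tree between [g A] and [b] has their common painted set. *)
  exists (g A), b; split; first by have /bounds/andP[] := gK A.
    move=> x; split; first exact: bounds.
    case/andP=> /CK_leP[_ sub_a] /CK_leP[_ sub_b]; apply/gamma_hat_painted.
    by apply/eqP; rewrite eqEsubset -{1}paint_a sub_a -paint_b.
- exists g => // A B; rewrite leEQ => sub_AB.
  have [paint_A size_A] := g_spec A; have [paint_B size_B] := g_spec B.
  apply/CK_leP; rewrite paint_A paint_B setCS; split=> // i lt_i.
  rewrite size_A // size_B // -(leq_add2l i).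
  apply: run_after_max => [|j /run_after_unpainted]; first exact: run_after_lt.
  by apply: contra; apply: nat_mem_sub; rewrite setCS.
Qed.
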